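(* Let $K\ge 0$ be an integer and let $a=(a_0,a_1,\ldots,a_K)\in\mathbb{R}^{K+1}$ with $a\neq(0,0,\ldots,0)$. Let $\overline{a}=(a_K,a_{K-1},\ldots,a_0)$ be the reversed tuple. Then $$Z(C_a)+Z(C_{\overline{a}})\ \ge\ 2K .$$
   Context: For a real tuple $a=(a_0,\ldots,a_K)$, define $C_a(x)=\sum_{k=0}^{K}a_k\cos(kx)$; thus $C_{\overline{a}}(x)=\sum_{k=0}^{K}a_{K-k}\cos(kx)$. For a real trigonometric polynomial $f$ that is not identically zero, $Z(f)$ denotes the number of real zeros of $f$ in one period $[0,2\pi)$, counted with multiplicity. *)

(* Defs.v *)
From mathcomp Require Import all_boot all_order all_algebra.
From mathcomp Require Import all_classical all_reals all_analysis.

Set Implicit Arguments.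
Unset Strict Implicit.
Unset Printing Implicit Defensive.

Import Order.TTheory GRing.Theory Num.Theory.
Import numFieldNormedType.Exports.

Local Open Scope classical_set_scope.
Local Open Scope ring_scope.

Definition cos_poly (R : realType) (n : nat) (a : n.-tuple R) (x : R) : R :=
  \sum_(k < n) tnth a k * cos (k%:R * x).

(* Meant for smooth [f]: [derive1n] is total, with no meaning where [f] is not
   differentiable.  Such an [m] is unique, and exists unless every iterated
   derivative of [f] vanishes at [x]. *)
Definition vanishes_to_order (R : realType) (f : R -> R) (x : R) (m : nat) :=
  (forall i, (i < m)%N -> derive1n i f x = 0) /\ derive1n m f x <> 0.

Definition multiplicity (R : realType) (f : R -> R) (x : R) : nat :=
  xget 0%N [set m | vanishes_to_order f x m].

(* The finitely supported sum is 0 by convention on an infinite support, which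
   does not occur for a trigonometric polynomial that is not identically zero. *)
Definition num_zeros (R : realType) (f : R -> R) : nat :=
  \big[addn/0%N]_(x \in [set x : R | 0 <= x < 2 * pi /\ f x = 0])
    multiplicity f x.

(* Main.v *)
(* With f = C_a and g = C_{rev a}, the identity cos((K - k)x) = (-1)^j cos(kx)
   at the nodes x_j = j pi / K gives g(x_j) = (-1)^j f(x_j).  So on each of the
   2K intervals [x_j, x_{j+1}] in a period, either f g changes sign, or an
   endpoint is a zero of both f and g.  Charging a common zero x_j to the
   interval on its right through f and to the one on its left through g, each
   interval receives its own zero of f in [x_j, x_{j+1}) or of g in
   (x_j, x_{j+1}]; multiplicities are only used through being positive. *)
Require Import Defs.
From mathcomp Require Import all_boot all_order all_algebra.
From mathcomp Require Import all_classical all_reals all_analysis.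
From mathcomp Require Import ring lra.
Import Order.TTheory GRing.Theory Num.Theory.
Import numFieldNormedType.Exports.
Local Open Scope ring_scope.

(** * Non-flatness of cosine polynomials *)

(** By linearity the weighted sums vanish for every polynomial in [u]. The product of the ['X - u j]
    over [j != k] is zero at all nodes except [u k], which isolates [w k]. *)
Lemma power_sums_eq0 (R : idomainType) (n : nat) (u w : 'I_n -> R) :
  injective u -> (forall i, \sum_(k < n) u k ^+ i * w k = 0) ->
  forall k, w k = 0.
Proof.
move=> u_inj sums0 k.
have horner0 (p : {poly R}) : \sum_(j < n) p.[u j] * w j = 0.
  under eq_bigr do rewrite horner_coef mulr_suml.
  rewrite exchange_big /= big1// => i _.
  under eq_bigr do rewrite -mulrA.
  by rewrite -mulr_sumr sums0 mulr0.
have := horner0 (\prod_(j < n | j != k) ('X - (u j)%:P)).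
rewrite (bigD1 k)//= [X in _ + X]big1 ?addr0 => [|i ik]; last first.
  by rewrite horner_prod (bigD1 i)//= hornerXsubC subrr !mul0r.
move/eqP; rewrite mulf_eq0 => /orP[|/eqP//].
rewrite horner_prod prodf_seq_eq0 => /hasP[j _ /andP[jk]].
by rewrite hornerXsubC subr_eq0 => /eqP/u_inj kj; rewrite kj eqxx in jk.
Qed.

Lemma derive1_sum_cos (R : realType) (n : nat) (c : 'I_n -> R) :
  derive1 (fun x => \sum_(k < n) c k * cos (k%:R * x)) =
  (fun x => \sum_(k < n) - (k%:R * c k) * sin (k%:R * x)).
Proof.
apply/funext => x; rewrite derive1E.
(* Point-free form, from which [derive_val] infers the derivative. *)
have -> : (fun y => \sum_(k < n) c k * cos (k%:R * y)) =
    \sum_(k < n) (c k \*: (cos \o (k%:R \*: id))).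
  by apply/funext => y; rewrite fct_sumE.
rewrite derive_val; apply: eq_bigr => k _.
by rewrite /GRing.scale/=; ring.
Qed.

Lemma derive1_sum_sin (R : realType) (n : nat) (c : 'I_n -> R) :
  derive1 (fun x => \sum_(k < n) c k * sin (k%:R * x)) =
  (fun x => \sum_(k < n) (k%:R * c k) * cos (k%:R * x)).
Proof.
apply/funext => x; rewrite derive1E.
have -> : (fun y => \sum_(k < n) c k * sin (k%:R * y)) =
    \sum_(k < n) (c k \*: (sin \o (k%:R \*: id))).
  by apply/funext => y; rewrite fct_sumE.
rewrite derive_val; apply: eq_bigr => k _.
by rewrite /GRing.scale/=; ring.
Qed.

Lemma derive1n_even_cos_poly (R : realType) (n : nat) (a : n.-tuple R) i :
  derive1n i.*2 (cos_poly a) =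
  (fun x => \sum_(k < n) ((- k%:R ^+ 2) ^+ i * tnth a k) * cos (k%:R * x)).
Proof.
elim: i => [|i IH].
  by apply/funext => x; apply: eq_bigr => k _; rewrite expr0 mul1r.
rewrite doubleS !derive1nS IH derive1_sum_cos derive1_sum_sin.
by apply/funext => x; apply: eq_bigr => k _; rewrite (exprS _ i); ring.
Qed.

(* The even and odd derivatives at x are, up to sign, the power sums of the
   distinct nodes -k^2 with weights a_k cos(kx) and k a_k sin(kx). *)
Lemma cos_poly_flat_eq0 (R : realType) (n : nat) (a : n.-tuple R) (x : R) :
  (forall i, derive1n i (cos_poly a) x = 0) -> a = [tuple 0 | _ < n].
Proof.
move=> flat.
have sq_inj : injective (fun k : 'I_n => - (k%:R : R) ^+ 2).
  move=> k j /oppr_inj/eqP.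
  by rewrite eqrXn2// eqr_nat => /eqP/val_inj.
have cosk0 := @power_sums_eq0 _ _ _ (fun k => tnth a k * cos (k%:R * x)) sq_inj.
have sink0 := @power_sums_eq0 _ _ _
  (fun k => k%:R * tnth a k * sin (k%:R * x)) sq_inj.
apply: eq_from_tnth => k; rewrite tnth_mktuple.
have /eqP : tnth a k * cos (k%:R * x) = 0.
  apply: cosk0 => i; rewrite -[RHS](flat i.*2) derive1n_even_cos_poly.
  by apply: eq_bigr => j _; rewrite mulrA.
rewrite mulf_eq0 => /orP[/eqP//|/eqP cosk].
have /eqP : k%:R * tnth a k * sin (k%:R * x) = 0.
  apply: sink0 => i; apply: oppr_inj; rewrite oppr0 -[RHS](flat i.*2.+1).
  rewrite derive1nS derive1n_even_cos_poly derive1_sum_cos -sumrN.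
  by apply: eq_bigr => j _; ring.
(* Where the cosine vanishes, [k] is nonzero and the sine is 1 or -1, so the odd derivatives force
   the coefficient to be 0. *)
have := cos2Dsin2 (k%:R * x); rewrite cosk expr0n add0r => /eqP.
rewrite sqrf_eq1; case: (eqVneq (k : nat) 0%N) => [k0|k0].
  by move: cosk; rewrite k0 mul0r cos0; move/eqP; rewrite oner_eq0.
move=> sink; rewrite !mulf_eq0 pnatr_eq0 (negPf k0)/= => /orP[/eqP//|/eqP s0].
by move: sink; rewrite s0 eq_sym oner_eq0 eq_sym oppr_eq0 oner_eq0.
Qed.

(** * Polynomials in the cosine *)

(** These are the Chebyshev polynomials of the first kind. Their recurrence uses two previous terms,
    so the induction carries a consecutive pair. *)
Lemma cos_natmul_poly (R : realType) (k : nat) :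
  exists p : {poly R}, forall x : R, cos (k%:R * x) = p.[cos x].
Proof.
suff [p [_ [pE _]]] : exists p q : {poly R},
    (forall x : R, cos (k%:R * x) = p.[cos x]) /\
    (forall x : R, cos (k.+1%:R * x) = q.[cos x]) by exists p.
elim: k => [|k [p [q [pE qE]]]].
  exists 1, 'X; split=> x; first by rewrite mul0r cos0 hornerE.
  by rewrite mul1r hornerX.
exists q, ('X * q *+ 2 - p); split=> // x.
rewrite !hornerE -pE -qE.
have -> : k.+2%:R * x = k.+1%:R * x + x by rewrite -[in LHS]addn1 natrD; ring.
have -> : k%:R * x = k.+1%:R * x - x by rewrite -[in RHS]addn1 natrD; ring.
by rewrite cosD cosB; ring.
Qed.

Lemma cos_poly_hornerE (R : realType) (n : nat) (a : n.-tuple R) :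
  exists p : {poly R}, forall x, cos_poly a x = p.[cos x].
Proof.
have [T TE] := choice (@cos_natmul_poly R).
exists (\sum_(k < n) (tnth a k)%:P * T k) => x.
rewrite horner_sum; apply: eq_bigr => k _.
by rewrite TE hornerM hornerC.
Qed.

(** * Lower bounds for the zero count *)

Lemma multiplicity_cos_poly_gt0 (R : realType) (n : nat) (a : n.-tuple R)
    (x : R) :
  a <> [tuple 0 | _ < n] -> cos_poly a x = 0 ->
  (0 < multiplicity (cos_poly a) x)%N.
Proof.
move=> a0 fx0.
(* Existence of an order excludes the default value 0 of [multiplicity]. *)
have order_ex : exists m, vanishes_to_order (cos_poly a) x m.
  have ex : exists i, derive1n i (cos_poly a) x != 0.
    apply: contrapT => all0; apply/a0/(@cos_poly_flat_eq0 _ _ _ x) => i.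
    by apply: contrapT => /eqP i0; apply: all0; exists i.
  case: (ex_minnP ex) => m /eqP m0 min; exists m; split=> // i im.
  by apply: contraTeq im => /min; rewrite -leqNgt.
have [_] := xgetPex 0%N order_ex; rewrite -/(multiplicity _ _).
by case: multiplicity.
Qed.

Lemma finite_roots (R : idomainType) (p : {poly R}) :
  p != 0 -> finite_set [set x | root p x]%classic.
Proof.
move=> p0; apply: contrapT => /infinite_set_fset - /(_ (size p))[B Broot].
apply/negP; rewrite -ltnNge.
apply: max_poly_roots => //; last exact: finmap.fset_uniq.
by apply/allP => x /Broot.
Qed.

(** Finiteness excludes the default value 0 of [num_zeros]. In a period a cosine value [y] is taken
    only at [acos y] and [2 * pi - acos y], so the zeros lie in two images of a finite root set. *)
Lemma finite_cos_poly_zeros (R : realType) (n : nat) (a : n.-tuple R) :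
  a <> [tuple 0 | _ < n] ->
  finite_set [set x : R | 0 <= x < 2 * pi /\ cos_poly a x = 0]%classic.
Proof.
move=> a0; have [p pE] := cos_poly_hornerE _ _ a.
have p0 : p != 0.
  apply/eqP => p0; apply/a0/(@cos_poly_flat_eq0 _ _ _ 0) => i.
  have -> : cos_poly a = cst 0 by apply/funext => x; rewrite pE p0 horner0.
  suff -> : derive1n i (cst 0 : R -> R) = cst 0 by [].
  elim: i => [//|i IH]; rewrite derive1nS IH.
  by apply/funext => x; rewrite derive1_cst.
have fin := finite_roots _ _ p0.
apply: (@sub_finite_set _ _
  ((@acos R) @` [set x | root p x] `|`
   (fun y => 2 * pi - acos y) @` [set x | root p x])%classic); last first.
  by rewrite finite_setU; split; exact: finite_image.
move=> x /= [/andP[x0 x2pi]]; rewrite pE => px0.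
have [xpi|pix] := leP x pi.
  left; exists (cos x); first exact/rootP.
  by rewrite cosK// in_itv/= x0.
right; exists (cos x); first exact/rootP.
have -> : cos x = cos (2 * pi - x).
  by rewrite cosB mulr_natl cos2pi sin2pi mul1r mul0r addr0.
by rewrite cosK ?in_itv/=; lra.
Qed.

Lemma size_le_num_zeros (R : realType) (n : nat) (a : n.-tuple R)
    (s : seq R) :
  a <> [tuple 0 | _ < n] -> uniq s ->
  (forall x, x \in s -> 0 <= x < 2 * pi /\ cos_poly a x = 0) ->
  (size s <= num_zeros (cos_poly a))%N.
Proof.
move=> a0 s_uniq s_zeros.
have fin := finite_cos_poly_zeros _ _ a a0.
rewrite /num_zeros fsbig_finite//=; set Z := finmap.enum_fset _.
have sZ : (size s <= size Z)%N.
  apply: uniq_leq_size => // x xs.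
  by rewrite /Z in_fset_set//; apply/mem_set/s_zeros.
apply: leq_trans sZ _; rewrite -sum1_size big_seq [leqRHS]big_seq.
apply: leq_sum => x.
by rewrite in_fset_set// => /set_mem[_]; exact: multiplicity_cos_poly_gt0.
Qed.

(** This serves the zeros of the reversed polynomial, whose intervals are closed on the right.
    Periodicity moves [2 * pi] to 0, a point not in [s]. *)
Lemma size_le_num_zeros_oc (R : realType) (n : nat) (a : n.-tuple R)
    (s : seq R) :
  a <> [tuple 0 | _ < n] -> uniq s ->
  (forall x, x \in s -> 0 < x <= 2 * pi /\ cos_poly a x = 0) ->
  (size s <= num_zeros (cos_poly a))%N.
Proof.
move=> a0 s_uniq s_zeros.
have [p pE] := cos_poly_hornerE _ _ a.
have pi0 := @pi_gt0 R.
pose t (x : R) := if x == 2 * pi then 0 else x.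
rewrite -(size_map t); apply: size_le_num_zeros => //.
  rewrite map_inj_in_uniq// => x y /s_zeros[/andP[x0 _] _].
  move=> /s_zeros[/andP[y0 _] _]; rewrite /t.
  by do 2 case: eqVneq => [->|_] //; lra.
move=> _ /mapP[x /s_zeros[/andP[x0 x2pi] fx0] ->]; rewrite /t.
case: eqVneq => [xE|xn]; last by rewrite fx0 lt_neqAle xn (ltW x0).
split; first lra.
by rewrite -[RHS]fx0 !pE xE mulr_natl cos2pi cos0.
Qed.

(** * Reversal and zeros between nodes *)

Lemma continuous_cos_poly (R : realType) (n : nat) (a : n.-tuple R) :
  continuous (cos_poly a).
Proof.
have [p pE] := cos_poly_hornerE _ _ a.
have -> : cos_poly a = horner p \o cos by apply/funext => x; rewrite pE.
move=> x; apply: continuous_comp; first exact: continuous_cos.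
exact: continuous_horner.
Qed.

Lemma tnth_rev_tuple (T : Type) (n : nat) (t : n.-tuple T) (k : 'I_n) :
  tnth (rev_tuple t) (rev_ord k) = tnth t k.
Proof.
have kn := ltn_ord k; have x0 := tnth t k.
rewrite !(tnth_nth x0)/= nth_rev size_tuple subnSK ?leq_subr//.
by rewrite subKn// ltnW.
Qed.

Lemma cos_poly_rev_node (R : realType) (K : nat) (a : K.+1.-tuple R)
    (j : nat) : (0 < K)%N ->
  cos_poly (rev_tuple a) (j%:R * (pi / K%:R)) =
  (-1) ^+ j * cos_poly a (j%:R * (pi / K%:R)).
Proof.
move=> K0; rewrite /cos_poly (reindex_inj rev_ord_inj)/= mulr_sumr.
have K0' : K%:R != 0 :> R by rewrite pnatr_eq0 -lt0n.
apply: eq_bigr => k _.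
rewrite tnth_rev_tuple.
have -> : (rev_ord k)%:R * (j%:R * (pi / K%:R)) =
    - (k%:R * (j%:R * (pi / K%:R))) + pi *+ j :> R.
  by rewrite /= subSS natrB -1?ltnS// -[pi *+ j]mulr_natl; field.
by rewrite (alternatingn (@cosDpi R)) cosN; ring.
Qed.

(** The boolean records which polynomial the zero belongs to. Each polynomial keeps one fixed closed
    end, so its zeros from different intervals are distinct. *)
Lemma exists_zero_between_nodes (R : realType) (K : nat)
    (a : K.+1.-tuple R) (j : nat) : (0 < K)%N ->
  exists bx : bool * R,
    if bx.1 then
      j%:R * (pi / K%:R) <= bx.2 < j.+1%:R * (pi / K%:R) /\
      cos_poly a bx.2 = 0
    else
      j%:R * (pi / K%:R) < bx.2 <= j.+1%:R * (pi / K%:R) /\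
      cos_poly (rev_tuple a) bx.2 = 0.
Proof.
move=> K0.
have h0 : 0 < pi / K%:R :> R by rewrite divr_gt0 ?pi_gt0 ?ltr0n.
have fgj := cos_poly_rev_node _ _ a j K0.
have fgj1 := cos_poly_rev_node _ _ a j.+1 K0.
have uv : j%:R * (pi / K%:R) < j.+1%:R * (pi / K%:R) :> R.
  by rewrite ltr_pM2r// ltr_nat.
move: fgj fgj1 uv; set u := j%:R * _; set v := j.+1%:R * _.
set f := cos_poly a; set g := cos_poly _ => gu gv uv.
have [fu0|fu0] := eqVneq (f u) 0; first by exists (true, u); rewrite lexx uv.
have [fv0|fv0] := eqVneq (f v) 0.
  by exists (false, v); rewrite /= lexx uv gv fv0 mulr0.
pose fg x := f x * g x.
have fgN : fg u * fg v < 0.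
  (* The signs at consecutive nodes are opposite, so the product is minus a square. *)
  have -> : fg u * fg v = - ((f u * f v) ^+ 2 * ((-1) ^+ j) ^+ 2).
    by rewrite /fg gu gv exprS; ring.
  by rewrite sqrr_sign mulr1 oppr_lt0 exprn_even_gt0//= mulf_neq0.
have [c] : exists2 c, c \in `[u, v] & fg c = 0.
  apply: IVT; first exact: ltW.
    apply: continuous_subspaceT => x.
    by apply: cvgM; exact: continuous_cos_poly.
  rewrite ge_min le_max.
  by case: (ltP (fg u) 0) fgN => ?; case: (ltP (fg v) 0) => ? ?; nra.
rewrite in_itv/= => /andP[uc cv] fgc0.
(* Since [fg] is nonzero at both ends, [c] is interior and fits either half-open interval. *)
have cu : u < c.
  rewrite lt_neqAle uc andbT; apply: contraTneq fgN => ->.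
  by rewrite fgc0 mul0r ltxx.
have vc : c < v.
  rewrite lt_neqAle cv andbT; apply: contraTneq fgN => <-.
  by rewrite fgc0 mulr0 ltxx.
have /eqP := fgc0; rewrite mulf_eq0 => /orP[/eqP fc|/eqP gc].
  by exists (true, c); rewrite /= uc vc.
by exists (false, c); rewrite /= cu cv.
Qed.

(** * Summation over the intervals of one period *)

Theorem proposition2p1 (R : realType) (K : nat) (a : K.+1.-tuple R)
    (ha : a <> [tuple 0 | _ < K.+1]) :
  (2 * K <= num_zeros (cos_poly a) + num_zeros (cos_poly (rev_tuple a)))%N.
Proof.
have [K0|K0] := posnP K; first by rewrite {1}K0.
have rev0 : rev_tuple a <> [tuple 0 | _ < K.+1].
  move=> E; apply: ha; apply: eq_from_tnth => k; rewrite tnth_mktuple.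
  have := congr1 (fun t => tnth t (rev_ord k)) E; rewrite tnth_mktuple => <-.
  by rewrite tnth_rev_tuple.
have h0 : 0 < pi / K%:R :> R by rewrite divr_gt0 ?pi_gt0 ?ltr0n.
have hE : 2 * pi = (2 * K)%:R * (pi / K%:R) :> R.
  by rewrite natrM; field; rewrite pnatr_eq0 -lt0n.
have [F FP] := choice (fun j => exists_zero_between_nodes _ _ a j K0).
pose s b := [seq (F j).2 | j <- iota 0 (2 * K) & (F j).1 == b].
have s_uniq b : uniq (s b).
  rewrite map_inj_in_uniq ?filter_uniq ?iota_uniq// => i j.
  rewrite !mem_filter => /andP[/eqP Fi _] /andP[/eqP Fj _] ij.
  (* A point lying in intervals [i] and [j] closed at the same end gives [i < j.+1] and
     [j < i.+1]. *)
  have := FP i; have := FP j; rewrite Fi Fj ij => {Fi Fj ij}.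
  move: (F j).2 => x; case: b => -[/andP[jx xj] _] [/andP[ix xi] _].
    have := le_lt_trans jx xi; have := le_lt_trans ix xj.
    by rewrite !ltr_pM2r// !ltr_nat !ltnS => ? ?; apply/anti_leq/andP.
  have := lt_le_trans jx xi; have := lt_le_trans ix xj.
  by rewrite !ltr_pM2r// !ltr_nat !ltnS => ? ?; apply/anti_leq/andP.
(* Each interval contributes to exactly one of the two lists. *)
have -> : (2 * K = size (s true) + size (s false))%N.
  rewrite !size_map !size_filter -[LHS](size_iota 0).
  rewrite -(count_predC (fun j => (F j).1)); congr (_ + _)%N.
    by apply: eq_count => j /=; rewrite eqb_id.
  by apply: eq_count => j /=; rewrite eqbF_neg.
apply: leq_add; [apply: size_le_num_zeros|apply: size_le_num_zeros_oc] => //.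
  move=> x /mapP[j].
  rewrite mem_filter mem_iota/= add0n => /andP[/eqP Fj jK] ->.
  have := FP j; rewrite Fj => -[/andP[jx xj] ->]; split=> //.
  apply/andP; split; first by rewrite (le_trans _ jx)// mulr_ge0// ltW.
  by rewrite (lt_le_trans xj)// hE ler_pM2r// ler_nat.
move=> x /mapP[j].
rewrite mem_filter mem_iota/= add0n => /andP[/eqP Fj jK] ->.
have := FP j; rewrite Fj => -[/andP[jx xj] ->]; split=> //.
apply/andP; split; first by rewrite (le_lt_trans _ jx)// mulr_ge0// ltW.
by rewrite (le_trans xj)// hE ler_pM2r// ler_nat.
Qed.
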